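(* The chord diagram of any rational knot has a support chord. That is, for every $n\ge 1$ and all nonzero integers $a_1,\dots,a_{2n}$, the bipartite signed chord diagram $C(a_1,\dots,a_{2n})$ of the rational knot corresponding to the continued fraction $[2a_1,2a_2,\dots,2a_{2n}]$ has a support chord.
   Context: Rational knots. For coprime integers $p,q$ with $p>0$ and a continued fraction expansion with nonzero integer denominators $$[b_1,\dots,b_m]=\cfrac{1}{b_1+\cfrac{1}{b_2+\cfrac{1}{\ddots+\cfrac{1}{b_m}}}}$$ of $p/q$, the rational (2-bridge) knot or link has a natural diagram, the plat-type closure of the four-strand braid $A^{b_1}B^{b_2}A^{b_3}\cdots$, where $A$ and $B$ are half-twists of two neighbouring pairs of strands (sharing one strand). Every rational knot has such an expansion with an even number of denominators, all even, $[2a_1,\dots,2a_{2n}]$; the natural diagram is then a matched diagram (its crossings split into full twists of antiparallel strands). Bipartite signed chord diagram. This is an oriented circle (drawn counterclockwise) with $2k$ distinct points split into $k$ pairs (chords), considered up to orientation-preserving homeomorphism of the circle, where each chord has a sign ($+$ or $-$) and is labelled inner or outer, such that no two inner chords cross each other and no two outer chords cross each other. It encodes a matched knot diagram: each chord is replaced by a full twist (two crossings of the same sign, determined by the sign of the chord) of the two antiparallel strands at its ends. The $2k$ arcs into which the points cut the circle correspond to the arcs of the knot diagram. The diagram $C(a_1,\dots,a_{2n})$. It has $|a_i|$ chords $c_{i,1},\dots,c_{i,|a_i|}$ of sign $\operatorname{sgn}(a_i)$ for each $i$; they are outer if $i$ is odd and inner if $i$ is even. Going once around the circle counterclockwise,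 one meets: first one endpoint of every chord, in lexicographic order of $(i,j)$; then the second endpoints of all outer chords, in reverse lexicographic order; then the second endpoints of all inner chords, in reverse lexicographic order. Matrix. For an endpoint $p$ of a chord let $p^-$ and $p^+$ be the arcs immediately before and after $p$ with respect to the orientation of the circle. The matrix $Q$ of a diagram with $k$ chords is the $2k\times 2k$ matrix over $\mathbb{Z}[t,t^{-1}]$ obtained from the Wirtinger presentation of the corresponding knot diagram by free (Fox) differentiation followed by replacing all generators by $t$. Its columns are indexed by the arcs, and each chord contributes two rows. For a chord with endpoints $p,q$ these rows, written as linear combinations of arcs (coefficients are added if arcs coincide), are: - negative inner: $t\,p^- + (1-t)\,q^+ - p^+$ and $t\,q^- + (1-t)\,p^+ - q^+$; - negative outer: $t\,p^- + (1-t)\,q^- - p^+$ and $t\,q^- + (1-t)\,p^- - q^+$; - positive inner: $-p^- + t\,p^+ + (1-t)\,q^-$ and $-q^- + t\,q^+ + (1-t)\,p^-$; - positive outer: $-p^- + t\,p^+ + (1-t)\,q^+$ and $-q^- + t\,q^+ + (1-t)\,p^+$. Support chord. A chord $\chi$ of a diagram with $k$ chords is a support chord if, after deleting from $Q$ the two rows corresponding to $\chi$, at least one of the minors of order $2k-2$ of the resulting $(2k-2)\times 2k$ matrix is invertible in $\mathbb{Z}[t,t^{-1}]$. *)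

(* Defs.v *)
From HB Require Import structures.
From mathcomp Require Import all_boot all_order all_algebra.
From mathcomp Require Import boolp.

Set Implicit Arguments.
Unset Strict Implicit.
Unset Printing Implicit Defensive.

Import GRing.Theory.

Local Open Scope ring_scope.

(* Z[t, t^-1], realised as the subring of the field of fractions of Z[t]
   formed by the quotients p / t^k. *)
Definition laurent_pred : {pred {fraction {poly int}}} :=
  fun x => `[< exists (p : {poly int}) (k : nat),
                 x = tofrac p / tofrac ('X^k) >].

Lemma tofracXn_neq0 k : tofrac ('X^k : {poly int}) != 0.
Proof. by rewrite tofrac_eq0 monic_neq0 // monicXn. Qed.

Fact laurent_subring_closed : subring_closed laurent_pred.
Proof.
split.
- by apply/asboolP; exists 1, 0%N; rewrite expr0 divr1 tofrac1.
- move=> _ _ /asboolP[p [k ->]] /asboolP[q [l ->]]; apply/asboolP.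
  exists (p * 'X^l - q * 'X^k), (k + l)%N.
  rewrite exprD !(tofracB, tofracM) -mulNr addf_div ?tofracXn_neq0 //.
  by rewrite mulNr.
- move=> _ _ /asboolP[p [k ->]] /asboolP[q [l ->]]; apply/asboolP.
  by exists (p * q), (k + l)%N; rewrite exprD !tofracM mulf_div.
Qed.

HB.instance Definition _ :=
  GRing.isSubringClosed.Build {fraction {poly int}} laurent_pred
    laurent_subring_closed.

Record laurent := Laurent {
  laurent_val : {fraction {poly int}};
  laurent_valP : laurent_val \in laurent_pred
}.

HB.instance Definition _ := [isSub for laurent_val].
HB.instance Definition _ := [Choice of laurent by <:].
HB.instance Definition _ := [SubChoice_isSubComNzRing of laurent by <:].

Definition laurent_unit : pred laurent :=
  fun x => (val x != 0) && ((val x)^-1 \in laurent_pred).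

Definition laurent_inv (x : laurent) : laurent := insubd x (val x)^-1.

Fact laurent_mulVx : {in laurent_unit, left_inverse 1 laurent_inv *%R}.
Proof.
move=> x /andP[x0 xV]; apply: val_inj.
by rewrite rmorphM rmorph1 /= /laurent_inv insubdK // mulVf.
Qed.

Fact laurent_unitPl (x y : laurent) : y * x = 1 -> laurent_unit x.
Proof.
move=> /(congr1 val); rewrite rmorphM rmorph1 /= => yx1.
have x0 : val x != 0.
  by apply/eqP => x0; move/eqP: yx1; rewrite x0 mulr0 eq_sym oner_eq0.
apply/andP; split=> //.
by rewrite -[_^-1]mul1r -yx1 mulfK //; exact: valP.
Qed.

Fact laurent_inv_out : {in [predC laurent_unit], laurent_inv =1 id}.
Proof.
move=> x; rewrite inE negb_and negbK /laurent_inv => /orP[/eqP x0|xV].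
  by apply: val_inj; rewrite x0 invr0 -x0 valKd.
by rewrite /insubd insubN.
Qed.

HB.instance Definition _ :=
  GRing.ComNzRing_hasMulInverse.Build laurent
    laurent_mulVx laurent_unitPl laurent_inv_out.

Fact laurentX_subproof : tofrac ('X : {poly int}) \in laurent_pred.
Proof. by apply/asboolP; exists 'X, 0%N; rewrite expr0 tofrac1 divr1. Qed.

Definition laurentX : laurent := Laurent laurentX_subproof.

Lemma laurentX_unit : laurentX \is a GRing.unit.
Proof.
apply/andP; split; first by rewrite /= -['X]expr1 tofracXn_neq0.
by apply/asboolP; exists 1, 1%N; rewrite expr1 tofrac1 div1r.
Qed.

Definition is_minor (R : comPzRingType) (m n r : nat) (A : 'M[R]_(m, n))
    (d : R) : Prop :=
  exists (f : 'I_r -> 'I_m) (g : 'I_r -> 'I_n),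
    [/\ {homo f : i j / (i < j)%N}, {homo g : i j / (i < j)%N}
      & d = \det (mxsub f g A)].

(* Interleaving: the two occurrences of c and the two of d alternate. *)
Definition crossing (T : eqType) (w : seq T) (c d : T) : bool :=
  subseq [:: c; d; c; d] w || subseq [:: d; c; d; c] w.

(* The circle is cut at a base point, and the diagram is recorded by the cyclic
   word listing, counterclockwise from there, the chord to which each of the
   2k points belongs.  Diagrams up to orientation-preserving homeomorphism are
   such words up to rotation and renaming of the chords. *)
Record chord_diagram := ChordDiagram {
  chord : finType;
  gauss_word : #|chord|.*2.-tuple chord;
  positive : pred chord;
  inner : pred chord;
  gauss_word_twice : forall c, count_mem c gauss_word = 2%N;
  gauss_word_noncrossing : forall c d, c != d -> inner c = inner d ->
    ~~ crossing gauss_word c d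
}.

Section Matrix.
Variable D : chord_diagram.

Definition point := 'I_(#|chord D|.*2).

Definition chord_of (p : point) : chord D := tnth (gauss_word D) p.

Definition mate (p : point) : point :=
  odflt p [pick q | (q != p) && (chord_of q == chord_of p)].

(* Arc number i ends at point number i. *)
Definition arc_before (p : point) : point := p.
Definition arc_after (p : point) : point := ordS p.

(* The row attached to the endpoint p of a chord whose other endpoint is q;
   the two rows of a chord are those of its two endpoints. *)
Definition fox_row (p : point) : 'rV[laurent]_(#|chord D|.*2) :=
  let q := mate p in
  let t := laurentX in
  let e := @delta_mx laurent 1 #|chord D|.*2 0 in
  match positive (chord_of p), inner (chord_of p) with
  | false, true =>
      t *: e (arc_before p) + (1 - t) *: e (arc_after q) - e (arc_after p)
  | false, false =>
      t *: e (arc_before p) + (1 - t) *: e (arc_before q) - e (arc_after p)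
  | true, true =>
      - e (arc_before p) + t *: e (arc_after p) + (1 - t) *: e (arc_before q)
  | true, false =>
      - e (arc_before p) + t *: e (arc_after p) + (1 - t) *: e (arc_after q)
  end.

Definition fox_matrix : 'M[laurent]_(#|chord D|.*2) :=
  \matrix_p fox_row p.

Definition delete_chord_rows (chi : chord D) :
    'M[laurent]_(#|[set p | chord_of p != chi]|, #|chord D|.*2) :=
  rowsub enum_val fox_matrix.

Definition support_chord (chi : chord D) : Prop :=
  exists2 d : laurent,
    is_minor (#|chord D|.*2 - 2) (delete_chord_rows chi) d
    & d \is a GRing.unit.

End Matrix.

Section Rational.
Variables (m : nat) (a : 'I_m -> int).

(* Indices start at 0, so c_{i,j} is the pair (i - 1, j - 1). *)
Definition rat_chord : finType := {i : 'I_m & 'I_(`|a i|)}.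

Definition rat_positive : pred rat_chord := fun c => 0 < a (tag c).

(* Outer for i odd, inner for i even, with i - 1 = tag c. *)
Definition rat_inner : pred rat_chord := fun c => odd (tag c).

Definition rat_lex : seq rat_chord :=
  [seq Tagged (fun i => 'I_(`|a i|)) j | i <- enum 'I_m, j <- enum 'I_(`|a i|)].

Definition rat_word : seq rat_chord :=
  rat_lex ++ rev [seq c <- rat_lex | ~~ rat_inner c]
          ++ rev [seq c <- rat_lex | rat_inner c].

Lemma rat_lex_uniq : uniq rat_lex.
Proof.
apply: allpairs_uniq_dep => [|i _|]; rewrite ?enum_uniq //.
by move=> [i j] [i' j'] _ _.
Qed.

Lemma mem_rat_lex c : c \in rat_lex.
Proof.
case: c => i j; apply/allpairsPdep; exists i, j; split; by rewrite ?mem_enum.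
Qed.

Lemma rat_word_twice c : count_mem c rat_word = 2%N.
Proof.
have E (P : pred rat_chord) : count_mem c (filter P rat_lex) = P c.
  by rewrite count_uniq_mem ?filter_uniq ?rat_lex_uniq // mem_filter mem_rat_lex
             andbT.
rewrite !count_cat !count_rev !E count_uniq_mem ?rat_lex_uniq // mem_rat_lex.
by case: rat_inner.
Qed.

Lemma size_rat_word : size rat_word == #|rat_chord|.*2.
Proof.
have sz : size rat_lex = #|rat_chord|.
  by rewrite cardE; apply/perm_size/uniq_perm;
     rewrite ?rat_lex_uniq ?enum_uniq // => c; rewrite mem_rat_lex mem_enum.
rewrite !size_cat !size_rev !size_filter [X in (_ + X)%N]addnC.
by rewrite (count_predC rat_inner) sz addnn.
Qed.

Lemma rat_word_noncrossing c d : c != d -> rat_inner c = rat_inner d ->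
  ~~ crossing rat_word c d.
Proof.
move=> ncd eio.
suff H x y : x != y -> rat_inner x = rat_inner y ->
    ~~ subseq [:: x; y; x; y] rat_word.
  by rewrite /crossing negb_or !H // eq_sym.
move=> {c d ncd eio} nxy eio; apply/negP.
pose P := pred2 x y.
have Pxyxy : all P [:: x; y; x; y] by rewrite /= !eqxx !orbT.
move=> sub.
have : subseq [:: x; y; x; y] (filter P rat_word) by rewrite subseq_filter Pxyxy.
pose s := filter P rat_lex.
have us : uniq s by rewrite filter_uniq ?rat_lex_uniq.
have ms z : (z \in s) = (z \in [:: x; y]).
  by rewrite mem_filter mem_rat_lex andbT !inE.
have Es : filter P rat_word = s ++ rev s.
  rewrite /rat_word !filter_cat !filter_rev.
  have F (b : bool) (Q : pred rat_chord) : Q x = b -> Q y = b ->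
      filter P (filter Q rat_lex) = if b then s else [::].
    move=> Qx Qy; rewrite -filter_predI.
    rewrite (@eq_filter _ _ (fun z => b && P z)).
      by case: (b) => //; rewrite filter_pred0.
    by move=> z /=; case: eqVneq => [->|_] /=; rewrite ?Qx ?andbT //;
       case: eqVneq => [->|_] /=; rewrite ?Qy ?andbT ?andbF.
  rewrite (F (rat_inner x) rat_inner) // (F (~~ rat_inner x)) -?eio //.
  by case: (rat_inner x); rewrite ?cats0.
have ps : perm_eq s [:: x; y].
  by apply: uniq_perm => //=; rewrite inE nxy.
have sz := perm_size ps.
rewrite Es => /size_subseq_leqif[_]; rewrite size_cat size_rev sz /= => /esym.
case: (s) sz us => [|u [|v []]] //= _; rewrite inE andbT => nuv.
rewrite /rev /= => /eqP[Eu _ Ev _].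
by rewrite -Eu Ev eqxx in nuv.
Qed.

Definition rational_diagram : chord_diagram :=
  @ChordDiagram rat_chord (Tuple size_rat_word) rat_positive rat_inner
    rat_word_twice rat_word_noncrossing.

End Rational.

(* Main.v *)
(* The two relations of a chord with endpoints p, q, whatever its sign and side,
   can be solved one after the other for the arcs after p and before q in terms of
   the arcs before p and after q, dividing only by -1 and t.  In the word of a rational knot,
   start from the arc before the first point and the arc that separates the
   second endpoints of the outer chords from those of the inner chords.  Reading
   the chords in lexicographic order, each but the last determines two new arcs,
   and in this way all 2k arcs are reached without the relations of the last
   chord, which is inner.  So every basis vector is, modulo the two basis vectors
   of the starting arcs, a combination of the remaining rows: the minor that omits
   these two columns has a left inverse, hence a unit determinant. *)
Require Import Defs.
From mathcomp Require Import all_boot all_order all_algebra.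
From mathcomp Require Import zify.

Import GRing.Theory.

Local Open Scope ring_scope.

(** * Unit minors from generation of basis vectors *)

Lemma homo_enum_val n (B : {set 'I_n}) :
  {homo (@enum_val 'I_n (mem B)) : i j / (i < j)%N}.
Proof.
move=> i j ij.
have srt : sorted ltn (map val (enum B)).
  apply: (subseq_sorted ltn_trans) (iota_ltn_sorted 0 n).
  rewrite -val_enum_ord; apply: map_subseq.
  by rewrite enumT /enum_mem; apply: filter_subseq.
have x0 : 'I_n := enum_val i.
have sz (l : 'I_#|B|) : (l < size (enum B))%N by rewrite -cardE.
rewrite !(enum_val_nth x0) -!(nth_map x0 0%N val) //.
by apply: (sorted_ltn_nth ltn_trans); rewrite ?inE ?size_map.
Qed.

Section ColumnGeneration.
Variables (R : comUnitRingType) (m n : nat) (A : 'M[R]_(m, n)) (B : {set 'I_n}).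

(** This is the row space of [A] taken modulo the basis vectors outside [B]. *)
Definition row_span_mod (v : 'rV[R]_n) : Prop :=
  exists w : 'rV_m, {in B, forall l, v 0 l = (w *m A) 0 l}.

Lemma row_span_mod_sub u v :
  row_span_mod u -> row_span_mod v -> row_span_mod (u - v).
Proof.
move=> [w Hw] [z Hz]; exists (w - z) => l Bl.
by rewrite mulmxBl !mxE Hw // Hz // !mxE.
Qed.

Lemma row_span_mod_add u v :
  row_span_mod u -> row_span_mod v -> row_span_mod (u + v).
Proof.
move=> [w Hw] [z Hz]; exists (w + z) => l Bl.
by rewrite mulmxDl !mxE Hw // Hz // !mxE.
Qed.

Lemma row_span_mod_scale c v : row_span_mod v -> row_span_mod (c *: v).
Proof.
move=> [w Hw]; exists (c *: w) => l Bl.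
by rewrite -scalemxAl !mxE Hw // !mxE.
Qed.

Lemma row_span_mod_unscale c v :
  c \is a GRing.unit -> row_span_mod (c *: v) -> row_span_mod v.
Proof.
by move=> cU /(row_span_mod_scale c^-1); rewrite scalerA mulVr // scale1r.
Qed.

Lemma row_span_mod_row i : row_span_mod (row i A).
Proof. by exists (delta_mx 0 i) => l _; rewrite -rowE. Qed.

Lemma row_span_mod_delta l : l \notin B -> row_span_mod (delta_mx 0 l).
Proof.
move=> Bl; exists 0 => l' Bl'; rewrite mul0mx !mxE /=.
by case: eqVneq Bl Bl' => // -> /negPf->.
Qed.

Lemma unit_minor :
    #|B| = m -> (forall l, row_span_mod (delta_mx 0 l)) ->
  exists2 d, is_minor m A d & d \is a GRing.unit.
Proof.
move=> cB genA.
(* The columns in [B] are listed increasingly, as [is_minor] requires. *)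
pose g (j : 'I_m) : 'I_n := enum_val (cast_ord (esym cB) j).
exists (\det (mxsub id g A)).
  by exists id, g; split=> // i j ij; apply: homo_enum_val.
(* Chosen coefficients; stacked for the [l] in [B], they form a left inverse of the square
   submatrix. *)
pose W l : 'rV_m := projT1 (boolp.cid (genA l)).
have WA l : {in B, forall j, (W l *m A) 0 j = (j == l)%:R}.
  move=> j Bj; rewrite -(projT2 (boolp.cid (genA l))) //.
  by rewrite mxE.
rewrite -unitmxE.
have /mulmx1_unit[] // :
  (\matrix_j W (g j)) *m (mxsub id g A) = 1%:M.
apply/matrixP => i j; rewrite [RHS]mxE.
have -> : (i == j) = (g j == g i).
  by rewrite /g (inj_eq enum_val_inj) (inj_eq (@cast_ord_inj _ _ _)) eq_sym.
rewrite -WA ?enum_valP // !mxE.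
by apply: eq_bigr => l _; rewrite !mxE.
Qed.

End ColumnGeneration.

(** * Solving the two relations of a chord *)

Section ChordDiagram.
Variable D : chord_diagram.
Implicit Types (p q : point D) (chi : chord D).

Lemma card_chord_of chi : #|[set p : point D | chord_of p == chi]| = 2%N.
Proof.
rewrite -(gauss_word_twice chi) -[in RHS](map_tnth_enum (gauss_word D)).
rewrite count_map cardE -size_filter; congr size.
by rewrite enumT /enum_mem; apply: eq_filter => p; rewrite !inE.
Qed.

Lemma card_chord_of_neq chi :
  #|[set p : point D | chord_of p != chi]| = (#|chord D|.*2 - 2)%N.
Proof.
have := cardsC [set p : point D | chord_of p == chi].
rewrite card_chord_of card_ord => E.
suff -> : [set p : point D | chord_of p != chi] =
    ~: [set p : point D | chord_of p == chi] by lia.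
by apply/setP => p; rewrite !inE.
Qed.

(** The point picked by [mate] is forced: a third point on the chord would contradict
    [card_chord_of]. *)
Lemma mateE p q : p != q -> chord_of p = chord_of q -> mate p = q.
Proof.
move=> npq cpq; rewrite /mate.
case: pickP => [q' /andP[nq'p /eqP cq']|/(_ q)] /=; last first.
  by rewrite eq_sym npq cpq eqxx.
apply/eqP; apply: contraT => nq'q.
have : [set p; q; q'] \subset [set x : point D | chord_of x == chord_of p].
  by apply/subsetP => z; rewrite !inE => /orP[/orP[]|] /eqP->;
     rewrite ?cq' -?cpq.
move/subset_leq_card; rewrite card_chord_of -setUA cardsU1 !inE.
by rewrite (negPf npq) eq_sym (negPf nq'p) cards2 eq_sym nq'q.
Qed.

(** The common form of the four kinds of relations. It hides sign and side, so that the propagation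
    along the word becomes purely combinatorial. *)
Definition arc_closed chi (V : point D -> Prop) : Prop :=
  forall p q, p != q -> chord_of p = chord_of q -> chord_of p != chi ->
    V (arc_before p) -> V (arc_after q) -> V (arc_after p) /\ V (arc_before q).

Lemma arc_closed_row_span chi (B : {set point D}) :
  arc_closed chi
    (fun l => row_span_mod _ _ _ (delete_chord_rows chi) B (delta_mx 0 l)).
Proof.
set V := row_span_mod _ _ _ _ _ => p q npq cpq ncp Vp Vq.
have rowV (z : point D) : chord_of z != chi -> V (fox_row z).
  move=> nz; have zP : z \in [set p : point D | chord_of p != chi] by rewrite inE.
  have -> : fox_row z =
      row (enum_rank_in zP z) (delete_chord_rows chi).
    by apply/rowP => l; rewrite !mxE enum_rankK_in.
  exact: row_span_mod_row.
have := rowV p ncp; have := rowV q; rewrite -cpq => /(_ ncp).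
have nqp : q != p by rewrite eq_sym.
rewrite /fox_row (mateE _ _ npq cpq) (mateE _ _ nqp (esym cpq)) -cpq.
have tU := laurentX_unit.
have Vs c v : V v -> V (c *: v) by apply: row_span_mod_scale.
have cancelD u v : V u -> V (u + v) -> V v.
  by move=> Vu Vuv; rewrite -(addKr u v) addrC; apply: row_span_mod_sub.
have cancelB u v : V u -> V (u - v) -> V v.
  by move=> Vu Vuv; rewrite -(subKr u v); apply: row_span_mod_sub.
have unsc v : V (laurentX *: v) -> V v by apply: row_span_mod_unscale.
have VD u v : V u -> V v -> V (u + v) by apply: row_span_mod_add.
(* For positive inner and negative outer chords the row of [q] is solved first, for the arc before
   [q]; in the other two cases the row of [p] comes first, for the arc after [p]. *)
case: positive; case: inner => Rq Rp.
- have Vq' : V (delta_mx 0 (arc_before q)).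
    by move: Rq; rewrite -addrA addrC; apply: cancelB; apply: VD; apply: Vs.
  split=> //; apply: unsc.
  move: Rp; rewrite addrAC; apply: cancelD.
  by rewrite addrC; apply: row_span_mod_sub => //; apply: Vs.
- have Vp' : V (delta_mx 0 (arc_after p)).
    apply: unsc.
    move: Rp; rewrite addrAC; apply: cancelD.
    by rewrite addrC; apply: row_span_mod_sub => //; apply: Vs.
  split=> //.
  by move: Rq; rewrite -addrA addrC; apply: cancelB; apply: VD; apply: Vs.
- have Vp' : V (delta_mx 0 (arc_after p)).
    by apply: cancelB Rp; apply: VD; apply: Vs.
  split=> //; apply: unsc.
  move: Rq; rewrite -addrA addrC; apply: cancelD.
  by apply: row_span_mod_sub => //; apply: Vs.
- have Vq' : V (delta_mx 0 (arc_before q)).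
    apply: unsc; move: Rq; rewrite -addrA addrC; apply: cancelD.
    by apply: row_span_mod_sub => //; apply: Vs.
  split=> //.
  by apply: cancelB Rp; apply: VD; apply: Vs.
Qed.

Lemma support_chord_of_generating_arcs chi x y :
    x != y ->
    (forall V, arc_closed chi V -> V x -> V y -> forall z, V z) ->
  support_chord chi.
Proof.
move=> nxy gen.
(* Dropping two columns and the two rows of [chi] leaves a square matrix. *)
have cB : #|~: [set x; y]| = #|[set p : point D | chord_of p != chi]|.
  by rewrite cardsCs setCK cards2 nxy card_ord card_chord_of_neq.
rewrite /support_chord -(card_chord_of_neq chi).
apply: (unit_minor _ _ _ _ _ cB).
by apply: gen; [apply: arc_closed_row_span | |];
   apply: row_span_mod_delta; rewrite !inE ?eqxx ?orbT.
Qed.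

(** * Propagation of known arcs along the word *)

Lemma support_chord_rational_word (P : pred (chord D)) (s : seq (chord D)) chi :
    let L := rcons s chi in
    tval (gauss_word D) =
      L ++ rev [seq c <- L | ~~ P c] ++ rev [seq c <- L | P c] ->
    uniq L -> P chi ->
  support_chord chi.
Proof.
move=> L wE uL Pchi.
set LO := [seq c <- L | ~~ P c] in wE; set LI := [seq c <- L | P c] in wE.
set N := #|chord D|.*2.
have sL : size L = (size s).+1 by rewrite size_rcons.
have sOI : (size LO + size LI)%N = size L.
  by rewrite addnC !size_filter (count_predC P).
have LOE : LO = [seq c <- s | ~~ P c] by rewrite /LO filter_rcons Pchi.
have LIE : LI = rcons [seq c <- s | P c] chi by rewrite /LI filter_rcons Pchi.
have NE : N = (size L + size L)%N.
  by rewrite /N -(size_tuple (gauss_word D)) wE !size_cat !size_rev sOI.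
have sLI : size LI = (size [seq c <- s | P c]).+1 by rewrite LIE size_rcons.
have N0 : (0 < N)%N by lia.
(* Reduction modulo [N] makes [pt N] the arc [pt 0], so [afterE] has no boundary case. *)
pose pt i : point D := Ordinal (ltn_pmod i N0).
have ptE (i : nat) (z : point D) : (i = z)%N -> pt i = z.
  by move=> iz; apply: val_inj; rewrite /= iz modn_small // ltn_ord.
have chordE i : (i < N)%N -> chord_of (pt i) = nth chi (gauss_word D) i.
  by move=> iN; rewrite /chord_of (tnth_nth chi) /= modn_small.
have afterE i : arc_after (pt i) = pt i.+1.
  by apply: val_inj; rewrite /= -addn1 modnDml addn1.
have nthO h : (h < size LO)%N ->
    nth chi (gauss_word D) (size L + size LO - h.+1) = nth chi LO h.
  move=> hO; rewrite wE nth_cat ltnNge leq_subRL; last by lia.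
  rewrite (_ : (_ <= _)%N = true) /=; last by lia.
  rewrite nth_cat size_rev (_ : (_ < _)%N = true); last by lia.
  by rewrite nth_rev; [congr nth | ]; lia.
have nthI h : (h < size LI)%N ->
    nth chi (gauss_word D) (N - h.+1) = nth chi LI h.
  move=> hI; rewrite wE nth_cat (_ : (_ < _)%N = false); last by lia.
  rewrite nth_cat size_rev (_ : (_ < _)%N = false); last by lia.
  by rewrite nth_rev; [congr nth | ]; lia.
apply: (support_chord_of_generating_arcs _ (pt 0) (pt (size L + size LO))).
  by rewrite -val_eqE /= mod0n modn_small; lia.
move=> V clV V0 V1.
have VN : V (pt N).
  by rewrite (_ : pt N = pt 0) //; apply: val_inj; rewrite /= modnn mod0n.
(* After [i] chords the known arcs form three runs: forward from 0, backward from
   [size L + size LO], and backward from [N]. The arc 0 starts both the first and the last run. *)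
have claim i : (i <= size s)%N ->
  [/\ forall j, (j <= i)%N -> V (pt j),
      forall h, (h <= count (predC P) (take i s))%N ->
        V (pt (size L + size LO - h)%N)
    & forall h, (h <= count P (take i s))%N -> V (pt (N - h)%N)].
  elim: i => [|i IHi] ile.
    by split=> j; rewrite ?take0 leqn0 => /eqP-> //; rewrite subn0 //.
  have {IHi} [IHu IHO IHI] := IHi (ltnW ile).
  set c := nth chi s i.
  have filterL Q : [seq d <- L | Q d] = [seq d <- take i s | Q d] ++
      [seq d <- c :: rcons (drop i.+1 s) chi | Q d].
    rewrite -filter_cat /L -{1}(cat_take_drop i s) (drop_nth chi ile).
    by rewrite rcons_cat.
  have takeS : take i.+1 s = rcons (take i s) c by rewrite (take_nth chi ile).
  have iN : (i < N)%N by lia.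
  have cE : chord_of (pt i) = c.
    by rewrite chordE // wE nth_cat sL ltnS (ltnW ile) nth_rcons ile.
  have nc : c != chi.
    move: uL; rewrite /L rcons_uniq => /andP[+ _].
    by apply: contraNneq => <-; apply: mem_nth.
  (* The arc before the first endpoint of [c] is the end of the first run; the arc after its second
     endpoint [q] will be the end of one of the two backward runs. *)
  have step (q : nat) : (size L <= q < N)%N -> nth chi (gauss_word D) q = c ->
      V (pt q.+1) -> V (pt i.+1) /\ V (pt q).
    move=> /andP[Lq qN] qE Vq.
    have := clV (pt i) (pt q); rewrite /arc_before !afterE; apply=> //.
    - by rewrite -val_eqE /= !modn_small //; lia.
    - by rewrite cE chordE.
    - by rewrite cE.
    - exact: IHu.
  have uS : V (pt i.+1) -> forall j, (j <= i.+1)%N -> V (pt j).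
    by move=> Vi j; rewrite leq_eqVlt => /orP[/eqP-> // | /IHu].
  rewrite takeS -!cats1 !count_cat /= !addn0.
  case Pc: (P c); rewrite /= ?addn0 ?addn1.
  - set h := count P (take i s) in IHI *.
    have LIh : nth chi LI h = c.
      by rewrite /LI filterL /= Pc nth_cat size_filter ltnn subnn.
    have hI : (h < size LI)%N.
      by rewrite /LI filterL /= Pc size_cat size_filter addnS ltnS leq_addr.
    have [||| Vi Vq] := step (N - h.+1)%N.
    + by lia.
    + by rewrite nthI.
    + by rewrite subnSK; [apply: IHI | lia].
    split=> // [|h']; first exact: uS.
    by rewrite leq_eqVlt => /orP[/eqP-> // | /IHI].
  - set h := count _ (take i s) in IHO *.
    have LOh : nth chi LO h = c.
      by rewrite /LO filterL /= Pc nth_cat size_filter ltnn subnn.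
    have hO : (h < size LO)%N.
      by rewrite /LO filterL /= Pc size_cat size_filter addnS ltnS leq_addr.
    have [||| Vi Vq] := step (size L + size LO - h.+1)%N.
    + by lia.
    + by rewrite nthO.
    + by rewrite subnSK; [apply: IHO | lia].
    split=> // [|h']; first exact: uS.
    by rewrite leq_eqVlt => /orP[/eqP-> // | /IHO].
(* As [chi] satisfies [P], the outer run is complete and reaches down to [size L]. The last run
   stops at [size L + size LO + 1], just above the second starting arc, so no gap remains. *)
have [//|] := claim (size s).
rewrite take_size -!size_filter -LOE => Vu VO VI' z.
have VI h : (h < size LI)%N -> V (pt (N - h)%N) by rewrite sLI; apply: VI'.
have zN : (z < N)%N := ltn_ord z.
have zE (i : nat) : (i = z)%N -> V (pt i) -> V z by move=> /ptE->.
have [zu|zL] := leqP z (size s); first exact: zE (Vu _ zu).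
have [zO|zI] := leqP z (size L + size LO).
  by apply: zE (VO (size L + size LO - z)%N _); lia.
by apply: zE (VI (N - z)%N _); lia.
Qed.

End ChordDiagram.

Theorem lemma8 (n : nat) (a : 'I_(n.*2) -> int) (hn : (0 < n)%N)
    (ha : forall i : 'I_(n.*2), a i != 0) :
  exists chi : chord (rational_diagram a), support_chord chi.
Proof.
suff [s [chi [sE ochi]]] : exists s (chi : rat_chord a),
    rat_lex a = rcons s chi /\ rat_inner chi.
  exists chi.
  refine (support_chord_rational_word (rational_diagram a) (@rat_inner _ a) s chi _ _ _).
  - by rewrite -sE.
  - by rewrite -sE; apply: rat_lex_uniq.
  - exact: ochi.
(* With indices starting at 0, the last one is the odd number [m], so the last block of chords is
   inner. *)
have [m mE] : exists m, n.*2 = m.+1 by exists n.*2.-1; rewrite prednK ?double_gt0.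
have om : odd m by rewrite -[odd m]negbK -oddS -mE odd_double.
move: n.*2 mE a ha => _ -> a ha.
rewrite /rat_lex enum_ordSr map_rcons flatten_rcons.
(* The last coefficient is nonzero, so its block does contain a last chord. *)
have : (0 < size (enum 'I_`|a ord_max|))%N by rewrite size_enum_ord absz_gt0.
case/lastP: (enum _) => // s j _.
rewrite map_rcons -rcons_cat; by do 2 eexists.
Qed.
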